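(* Let $A>0$ be a real number and consider the difference equation $$\triangle^2 y_{n-1}-A\sin y_n=0,\qquad n\in\mathbb{Z}.$$ For each $\xi\in\mathbf{\Theta}=\{2k\pi:k\in\mathbb{Z}\}$, there exist at least two heteroclinic orbits of this equation joining $\xi-2\pi$ to $\xi$, and at least two heteroclinic orbits of this equation joining $\xi$ to $\xi+2\pi$.
   Context: Here $y_n\in\mathbb{R}$ for all $n\in\mathbb{Z}$, $\triangle y_n=y_{n+1}-y_n$ is the forward difference and $\triangle^2y_n=\triangle(\triangle y_n)$, so $\triangle^2 y_{n-1}=y_{n+1}-2y_n+y_{n-1}$. (The equation is obtained from the discrete pendulum equation $\triangle^2x_{n-1}+A\sin x_n=0$ by the substitution $y_n=x_n-\pi$.) For a convergent bi-infinite sequence $\{y_n\}_{n\in\mathbb{Z}}$, write $y_{\pm\infty}=\lim_{n\to\pm\infty}y_n$. An equilibrium of the equation is a real number $\xi$ such that the constant sequence $\xi$ is a solution. A heteroclinic orbit (or heteroclinic solution) is a solution $y:\mathbb{Z}\to\mathbb{R}$ for which there are two equilibria $\xi\neq\eta$ with $y_{-\infty}=\xi$ and $y_{+\infty}=\eta$. A heteroclinic orbit is said to join two equilibria $a$ and $b$ (equivalently, to join $a$ to $b$) if $\{y_{-\infty},y_{+\infty}\}=\{a,b\}$; both directions are counted. Orbits are counted as distinct if they are distinct as sequences. *)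

(* Defs.v *)
From Stdlib Require Import Reals ZArith.
From Coquelicot Require Import Coquelicot.
Open Scope R_scope.

Definition fdiff (y : Z -> R) (n : Z) : R := y (n + 1)%Z - y n.

Definition is_solution (A : R) (y : Z -> R) : Prop :=
  forall n : Z, fdiff (fdiff y) (n - 1)%Z - A * sin (y n) = 0.

Definition is_equilibrium (A : R) (xi : R) : Prop :=
  is_solution A (fun _ => xi).

Definition lim_pinfty (y : Z -> R) (l : R) : Prop :=
  is_lim_seq (fun n : nat => y (Z.of_nat n)) l.

Definition lim_minfty (y : Z -> R) (l : R) : Prop :=
  is_lim_seq (fun n : nat => y (- Z.of_nat n)%Z) l.

Definition is_heteroclinic (A : R) (y : Z -> R) : Prop :=
  is_solution A y /\
  exists xi eta : R,
    is_equilibrium A xi /\ is_equilibrium A eta /\ xi <> eta /\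
    lim_minfty y xi /\ lim_pinfty y eta.

(* The limits at -oo and +oo form the unordered pair {a, b}: both directions
   are allowed. *)
Definition joins (y : Z -> R) (a b : R) : Prop :=
  (lim_minfty y a /\ lim_pinfty y b) \/ (lim_minfty y b /\ lim_pinfty y a).

Definition at_least_two (P : (Z -> R) -> Prop) : Prop :=
  exists y z : Z -> R, y <> z /\ P y /\ P z.

Definition Theta (xi : R) : Prop := exists k : Z, xi = 2 * IZR k * PI.

(* Main.v *)
Require Import Defs.
From Stdlib Require Import Reals ZArith Lra Lia.
From Coquelicot Require Import Coquelicot.
Open Scope R_scope.

(** Shooting.  Start at [PI] with second value [s] and iterate forward.  The
    parameters [s] for which the orbit decreases to below [0], and those for
    which it turns upwards while still positive, form two disjoint open sets;
    the first contains [0] but no [s < PI] close to [PI].  By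
    connectedness some [s] lies in neither, and its orbit decreases strictly to a
    zero of [sin] in [[0, PI)], that is, to [0].  Since
    [2 * PI - y] solves the equation whenever [y] does, reflecting this half
    orbit in the point [(0, PI)] gives a heteroclinic orbit from [2 * PI] to
    [0]; reversing time gives a second one. *)

(** * The shooting orbit and the two classes of parameters *)

Fixpoint shoot (A s : R) (n : nat) : R :=
  match n with
  | O => PI
  | S O => s
  | S (S k as m) => 2 * shoot A s m - shoot A s k + A * sin (shoot A s m)
  end.

(** Like [turns], this asks for finitely many strict inequalities between iterates, so it persists
    under small changes of [s]. *)
Definition falls (A s : R) : Prop :=
  exists n, shoot A s n < 0 /\
    forall k, (k < n)%nat -> shoot A s (S k) < shoot A s k.

Definition turns (A s : R) : Prop :=
  exists n, shoot A s n < shoot A s (S n) /\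
    forall k, (k <= n)%nat -> 0 < shoot A s k.

Lemma shoot_step (A s : R) (n : nat) :
  shoot A s (S (S n)) =
  2 * shoot A s (S n) - shoot A s n + A * sin (shoot A s (S n)).
Proof. reflexivity. Qed.

(** * Continuity in the parameter and openness *)

Lemma continuous_shoot (A : R) (n : nat) (s : R) :
  continuous (fun t => shoot A t n) s.
Proof.
  (* The recurrence has order two, so the induction carries two consecutive iterates. *)
  enough (continuous (fun t => shoot A t n) s /\
          continuous (fun t => shoot A t (S n)) s) by tauto.
  induction n as [|n [IH1 IH2]].
  - split; [apply continuous_const | apply continuous_id].
  - split; [exact IH2|].
    apply (continuous_plus (fun t => 2 * shoot A t (S n) - shoot A t n)
                           (fun t => A * sin (shoot A t (S n)))).
    + apply (continuous_minus (fun t => 2 * shoot A t (S n))); [|exact IH1].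
      apply (continuous_scal_r 2 (fun t => shoot A t (S n))); exact IH2.
    + apply (continuous_scal_r A (fun t => sin (shoot A t (S n)))).
      apply (continuous_comp (fun t => shoot A t (S n)) sin); [exact IH2|].
      apply continuous_sin.
Qed.

Lemma locally_lt (f g : R -> R) (x : R) :
  continuous f x -> continuous g x -> f x < g x -> locally x (fun t => f t < g t).
Proof.
  intros Hf Hg Hlt.
  assert (Hc : continuous (fun t => g t - f t) x) by now apply (continuous_minus g f).
  assert (H0 : 0 < g x - f x) by lra.
  assert (Hl : locally x (fun t => 0 < g t - f t)) by exact (Hc _ (open_gt 0 _ H0)).
  revert Hl; apply filter_imp; intros t Ht; lra.
Qed.

Lemma locally_bounded_forall (P : nat -> R -> Prop) (n : nat) (x : R) :
  (forall k, (k < n)%nat -> locally x (P k)) ->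
  locally x (fun t => forall k, (k < n)%nat -> P k t).
Proof.
  induction n as [|n IH]; intros H.
  - apply filter_forall; intros t k Hk; lia.
  - assert (H1 := IH (fun k Hk => H k (Nat.lt_lt_succ_r _ _ Hk))).
    generalize (filter_and _ _ H1 (H n (Nat.lt_succ_diag_r n))).
    apply filter_imp; intros t [Ht1 Ht2] k Hk.
    destruct (Nat.eq_dec k n) as [->|Hn]; [exact Ht2 | apply Ht1; lia].
Qed.

Lemma open_falls (A : R) : open (falls A).
Proof.
  intros s [n [Hn Hk]].
  assert (H1 := locally_lt _ _ s (continuous_shoot A n s) (continuous_const 0 s) Hn).
  assert (H2 := locally_bounded_forall _ n s (fun k H =>
    locally_lt _ _ s (continuous_shoot A (S k) s) (continuous_shoot A k s) (Hk k H))).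
  generalize (filter_and _ _ H1 H2); apply filter_imp.
  intros t [Ht1 Ht2]; exists n; split; assumption.
Qed.

Lemma open_turns (A : R) : open (turns A).
Proof.
  intros s [n [Hn Hk]].
  assert (H1 := locally_lt _ _ s (continuous_shoot A n s)
                                 (continuous_shoot A (S n) s) Hn).
  assert (H2 := locally_bounded_forall _ (S n) s (fun k H =>
    locally_lt _ _ s (continuous_const 0 s) (continuous_shoot A k s)
      (Hk k (proj1 (Nat.lt_succ_r k n) H)))).
  generalize (filter_and _ _ H1 H2); apply filter_imp.
  intros t [Ht1 Ht2]; exists n; split; [exact Ht1|].
  intros k Hkn; apply Ht2; lia.
Qed.

(** * A parameter in neither class *)

Lemma falls_turns_disjoint (A s : R) : falls A s -> turns A s -> False.
Proof.
  intros [n [Hn Hnk]] [m [Hm Hmk]].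
  destruct (le_lt_dec n m) as [H|H].
  - specialize (Hmk n H); lra.
  - specialize (Hnk m H); lra.
Qed.

Lemma falls_0 (A : R) : falls A 0.
Proof.
  assert (HPI := PI_RGT_0).
  exists 2%nat; split.
  - rewrite shoot_step; simpl; rewrite sin_0; lra.
  - intros [|[|k]] Hk; [simpl; lra | | lia].
    rewrite shoot_step; simpl; rewrite sin_0; lra.
Qed.

(* The steps never exceed the first one while the orbit decreases within
   [[0, PI]], so an orbit with a short first step cannot jump over
   [[PI/3, 2*PI/3]], where the term [A * sin] exceeds the step and turns the
   orbit round. *)
Lemma not_falls_near_PI (A s : R) :
  0 < A -> PI - s < PI / 3 -> PI - s < A / 2 -> ~ falls A s.
Proof.
  intros HA H3 HA2 [N [HN Hdec]].
  assert (HPI := PI_RGT_0).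
  assert (Hinv : forall k, (k <= N)%nat -> 2 * PI / 3 < shoot A s k <= PI /\
                   ((k < N)%nat -> shoot A s k - shoot A s (S k) <= PI - s)).
  { induction k as [|k IH]; intros HkN.
    - simpl; split; [lra | intros; lra].
    - destruct (IH ltac:(lia)) as [[Hlo Hhi] Hd].
      specialize (Hd HkN).
      assert (H1 := Hdec k HkN).
      assert (Hstep := shoot_step A s k).
      destruct (Rlt_le_dec (2 * PI / 3) (shoot A s (S k))) as [Hgt|Hle].
      + split; [lra|]; intros _.
        assert (0 <= sin (shoot A s (S k))) by (apply sin_ge_0; lra).
        nra.
      + exfalso.
        destruct (Nat.eq_dec (S k) N) as [HE|HE]; [rewrite HE in *; lra|].
        assert (H2 := Hdec (S k) ltac:(lia)).
        (* The iterate lies in [(PI/3, 2*PI/3]], so its distance to [PI/2] is below [PI/3] and its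
           sine is at least [1/2]. Hence [A * sin] is at least [A/2], more than the last step,
           against [H2]. *)
        assert (Hcos : 1 / 2 <= cos (PI / 2 - shoot A s (S k))).
        { rewrite <- cos_PI3.
          destruct (Rle_dec 0 (PI / 2 - shoot A s (S k))).
          - apply cos_decr_1; lra.
          - rewrite <- (cos_neg (PI / 2 - shoot A s (S k))).
            apply cos_decr_1; lra. }
        rewrite cos_shift in Hcos.
        nra. }
  destruct (Hinv N (le_n N)) as [[H _] _]; lra.
Qed.

(** Connectedness by a supremum: take the least upper bound [s] of the falling parameters up to
    [PI - e]. Were [s] falling, so would be slightly larger parameters; were it turning, no falling
    parameter could lie close to its left. *)
Lemma shoot_separatrix (A : R) :
  0 < A -> exists s, 0 < s < PI /\ ~ falls A s /\ ~ turns A s.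
Proof.
  intros HA.
  assert (HPI := PI_RGT_0).
  (* Half of each threshold in [not_falls_near_PI], so that [PI - e] itself meets the strict
     bounds. *)
  set (e := Rmin (PI / 6) (A / 4)).
  assert (He1 : e <= PI / 6) by apply Rmin_l.
  assert (He2 : e <= A / 4) by apply Rmin_r.
  assert (He0 : 0 < e) by (apply Rmin_pos; lra).
  assert (Hnear : forall t, PI - e <= t -> ~ falls A t)
    by (intros t Ht; apply not_falls_near_PI; lra).
  destruct (completeness (fun t => t <= PI - e /\ falls A t)) as [s [Hub Hlub]].
  { exists (PI - e); intros t [Ht _]; exact Ht. }
  { exists 0; split; [lra | apply falls_0]. }
  assert (Hs1 : s <= PI - e) by (apply Hlub; intros t [Ht _]; exact Ht).
  assert (Hs0 : 0 <= s) by (apply Hub; split; [lra | apply falls_0]).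
  assert (Hnf : ~ falls A s).
  { intros Hf.
    assert (s <> PI - e) by (intros E; apply (Hnear s); [lra | exact Hf]).
    destruct (open_falls A s Hf) as [d Hd].
    assert (Hdpos := cond_pos d).
    set (r := Rmin (d / 2) (PI - e - s)).
    assert (Hr1 : r <= d / 2) by apply Rmin_l.
    assert (Hr2 : r <= PI - e - s) by apply Rmin_r.
    assert (Hr0 : 0 < r) by (apply Rmin_pos; lra).
    assert (s + r <= s); [|lra].
    apply Hub; split; [lra|]; apply Hd.
    change (Rabs (s + r - s) < d); rewrite Rabs_pos_eq; lra. }
  exists s; split; [split; [|lra]|split; [exact Hnf|]].
  - destruct (Rle_lt_or_eq_dec 0 s Hs0) as [|E]; [assumption|].
    exfalso; apply Hnf; rewrite <- E; apply falls_0.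
  - intros Ht.
    destruct (open_turns A s Ht) as [d Hd].
    assert (Hdpos := cond_pos d).
    assert (s <= s - d); [|lra].
    apply Hlub; intros t [Ht1 Htf].
    apply Rnot_lt_le; intros Hlt.
    assert (t <= s) by (apply Hub; split; assumption).
    apply (falls_turns_disjoint A t Htf), Hd.
    change (Rabs (t - s) < d); rewrite Rabs_left1; lra.
Qed.

(** * The separating orbit decreases to zero *)

(** A strict violation is [falls] or [turns] at once; the borderline equalities become one of them a
    step later. *)
Lemma separatrix_decreasing (A s : R) :
  0 < A -> 0 < s < PI -> ~ falls A s -> ~ turns A s ->
  forall n, 0 < shoot A s (S n) < shoot A s n.
Proof.
  intros HA Hs Hnf Hnt.
  enough (Hall : forall n k, (k <= n)%nat -> 0 < shoot A s (S k) < shoot A s k)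
    by (intros n; apply (Hall n n), le_n).
  induction n as [|n IH]; intros k Hk.
  { replace k with 0%nat by lia; simpl; lra. }
  destruct (Nat.eq_dec k (S n)) as [->|Hne]; [|apply IH; lia].
  assert (Hpos : forall j, (j <= S n)%nat -> 0 < shoot A s j).
  { intros [|j] Hj; [exact PI_RGT_0 | apply IH; lia]. }
  (* The index starts at 1 because the orbit begins at [PI], where the sine vanishes. *)
  assert (HltPI : forall j, (j <= n)%nat -> shoot A s (S j) < PI).
  { induction j as [|j IHj]; intros Hj; [simpl; lra|].
    generalize (IH (S j) Hj) (IHj ltac:(lia)); lra. }
  assert (Hsin : 0 < sin (shoot A s (S n)))
    by (apply sin_gt_0; [apply Hpos | apply HltPI]; lia).
  assert (Hn := IH n (le_n n)).
  assert (Hstep := shoot_step A s (S n)).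
  assert (Hle : shoot A s (S (S n)) <= shoot A s (S n)).
  { apply Rnot_lt_le; intros Hlt; apply Hnt; exists (S n); split; assumption. }
  assert (Hlt : shoot A s (S (S n)) < shoot A s (S n)).
  (* After a zero step at a point with positive sine, the next step goes up. *)
  { destruct Hle as [|E]; [assumption|].
    exfalso; apply Hnt; exists (S (S n)); split.
    - rewrite E in Hstep; rewrite Hstep, E; nra.
    - intros j Hj; destruct (Nat.eq_dec j (S (S n))) as [->|];
        [rewrite E; apply Hpos; lia | apply Hpos; lia]. }
  split; [|exact Hlt].
  destruct (Rtotal_order (shoot A s (S (S n))) 0) as [Hneg|[Hz|]]; [| |lra];
    exfalso; apply Hnf.
  - exists (S (S n)); split; [exact Hneg|].
    intros j Hj; destruct (Nat.eq_dec j (S n)) as [->|]; [exact Hlt | apply IH; lia].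
  (* After landing exactly on 0, the next iterate is minus the previous one, hence negative. *)
  - rewrite Hz, sin_0 in Hstep.
    exists (S (S (S n))); split; [lra|].
    intros j Hj; destruct (Nat.eq_dec j (S (S n))) as [->|]; [lra|].
    destruct (Nat.eq_dec j (S n)) as [->|]; [exact Hlt | apply IH; lia].
Qed.

Lemma is_lim_seq_shoot_sin (A s l : R) :
  A <> 0 -> is_lim_seq (shoot A s) l -> sin l = 0.
Proof.
  intros HA Hl.
  assert (Hl1 : is_lim_seq (fun n => shoot A s (S n)) l)
    by now apply -> is_lim_seq_incr_1.
  assert (Hl2 : is_lim_seq (fun n => shoot A s (S (S n))) l)
    by now apply -> (is_lim_seq_incr_1 (fun n => shoot A s (S n))).
  assert (Hsin : is_lim_seq (fun n => sin (shoot A s (S n))) (sin l)).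
  { apply (is_lim_seq_continuous sin); [apply continuity_sin | exact Hl1]. }
  assert (Hr : is_lim_seq (fun n => shoot A s (S (S n))) (2 * l - l + A * sin l)).
  { apply (is_lim_seq_plus' (fun n => 2 * shoot A s (S n) - shoot A s n)
                            (fun n => A * sin (shoot A s (S n)))).
    - apply is_lim_seq_minus'; [|exact Hl].
      apply (is_lim_seq_scal_l _ 2 l); exact Hl1.
    - apply (is_lim_seq_scal_l _ A (sin l)); exact Hsin. }
  assert (E : Finite l = Finite (2 * l - l + A * sin l)).
  { rewrite <- (is_lim_seq_unique _ _ Hl2); exact (is_lim_seq_unique _ _ Hr). }
  injection E; intros E'.
  apply (Rmult_eq_reg_l A); [lra | exact HA].
Qed.

Lemma separatrix_limit (A s : R) :
  0 < A -> 0 < s < PI -> ~ falls A s -> ~ turns A s -> is_lim_seq (shoot A s) 0.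
Proof.
  intros HA Hs Hnf Hnt.
  assert (Hdec := separatrix_decreasing A s HA Hs Hnf Hnt).
  assert (Hpos : forall n, 0 <= shoot A s n)
    by (intros n; generalize (Hdec n); lra).
  destruct (ex_finite_lim_seq_decr (shoot A s) 0) as [l Hl];
    [intros n; generalize (Hdec n); lra | exact Hpos |].
  assert (Hl0 : 0 <= l).
  { exact (is_lim_seq_le (fun _ => 0) _ 0 l Hpos (is_lim_seq_const 0) Hl). }
  (* Comparison with [s < PI] rather than with the initial value [PI] excludes the zero of [sin] at
     [PI]. *)
  assert (Hls : l <= s).
  { apply (is_lim_seq_le (fun n => shoot A s (S n)) (fun _ => s) l s);
      [| now apply -> is_lim_seq_incr_1 | apply is_lim_seq_const].
    induction n as [|n IH]; [simpl; lra | generalize (Hdec (S n)); lra]. }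
  assert (Hsin := is_lim_seq_shoot_sin A s l ltac:(lra) Hl).
  destruct (Rle_lt_or_eq_dec 0 l Hl0) as [Hlt|E]; [|now rewrite E].
  assert (0 < sin l) by (apply sin_gt_0; lra); lra.
Qed.

(** * Symmetries of the equation *)

Lemma is_solution_iff (A : R) (y : Z -> R) :
  is_solution A y <->
  forall n, y (n + 1)%Z + y (n - 1)%Z = 2 * y n + A * sin (y n).
Proof.
  unfold is_solution, fdiff.
  split; intros H n; specialize (H n);
    replace (n - 1 + 1)%Z with n in * by lia; lra.
Qed.

Lemma is_solution_opp (A : R) (y : Z -> R) :
  is_solution A y -> is_solution A (fun n => y (- n)%Z).
Proof.
  rewrite !is_solution_iff; intros H n; specialize (H (- n)%Z).
  replace (- (n + 1))%Z with (- n - 1)%Z by lia.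
  replace (- (n - 1))%Z with (- n + 1)%Z by lia.
  lra.
Qed.

Lemma sin_period_Z (x : R) (k : Z) : sin (x + 2 * IZR k * PI) = sin x.
Proof.
  destruct (Z_le_gt_dec 0 k) as [Hk|Hk].
  - rewrite <- (Z2Nat.id k Hk), <- INR_IZR_INZ; apply sin_period.
  - rewrite <- (sin_period (x + 2 * IZR k * PI) (Z.to_nat (- k))).
    f_equal; rewrite INR_IZR_INZ, Z2Nat.id, opp_IZR by lia; ring.
Qed.

Lemma is_solution_translate (A : R) (y : Z -> R) (k : Z) :
  is_solution A y -> is_solution A (fun n => y n + 2 * IZR k * PI).
Proof.
  rewrite !is_solution_iff; intros H n; rewrite sin_period_Z; specialize (H n); lra.
Qed.

Lemma is_equilibrium_Theta (A : R) (xi : R) : Theta xi -> is_equilibrium A xi.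
Proof.
  intros [k ->]; unfold is_equilibrium; rewrite is_solution_iff; intros n.
  rewrite <- (Rplus_0_l (2 * IZR k * PI)), sin_period_Z, sin_0; ring.
Qed.

(** * Reflection of the half orbit and the heteroclinic pair *)

Definition reflected (z : nat -> R) (n : Z) : R :=
  if Z_le_dec 0 n then z (Z.to_nat n) else 2 * PI - z (Z.to_nat (- n)).

Lemma reflected_nonneg (z : nat -> R) (n : nat) : reflected z (Z.of_nat n) = z n.
Proof.
  unfold reflected; destruct (Z_le_dec 0 (Z.of_nat n)); [|lia].
  now rewrite Nat2Z.id.
Qed.

(* The two branches agree at [0] because the orbit starts at the centre of
   reflection. *)
Lemma reflected_nonpos (z : nat -> R) (n : nat) :
  z 0%nat = PI -> reflected z (- Z.of_nat n) = 2 * PI - z n.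
Proof.
  intros H0; unfold reflected; destruct (Z_le_dec 0 (- Z.of_nat n)).
  - replace n with 0%nat by lia; simpl; rewrite H0; ring.
  - now rewrite Z.opp_involutive, Nat2Z.id.
Qed.

Lemma is_solution_reflected_shoot (A s : R) :
  is_solution A (reflected (shoot A s)).
Proof.
  rewrite is_solution_iff; intros n.
  destruct (Z.lt_trichotomy n 0) as [Hn|[->|Hn]].
  - destruct (Z_of_nat_complete (- n - 1) ltac:(lia)) as [m Hm].
    replace (n + 1)%Z with (- Z.of_nat m)%Z by lia.
    replace (n - 1)%Z with (- Z.of_nat (S (S m)))%Z by lia.
    replace n with (- Z.of_nat (S m))%Z by lia.
    rewrite !reflected_nonpos, shoot_step by reflexivity.
    replace (sin (2 * PI - shoot A s (S m))) with (- sin (shoot A s (S m))); [ring|].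
    rewrite <- sin_neg, <- (sin_period_Z (- shoot A s (S m)) 1).
    f_equal; ring.
  (* Where the halves meet, the neighbours [s] and [2 * PI - s] sum to [2 * PI], and
     [sin PI = 0]. *)
  - change (0 + 1)%Z with (Z.of_nat 1); change (0 - 1)%Z with (- Z.of_nat 1)%Z.
    change 0%Z with (Z.of_nat 0).
    rewrite reflected_nonpos, !reflected_nonneg by reflexivity.
    simpl; rewrite sin_PI; ring.
  - destruct (Z_of_nat_complete (n - 1) ltac:(lia)) as [m Hm].
    replace (n + 1)%Z with (Z.of_nat (S (S m))) by lia.
    replace (n - 1)%Z with (Z.of_nat m) by lia.
    replace n with (Z.of_nat (S m)) by lia.
    rewrite !reflected_nonneg, shoot_step; ring.
Qed.

Lemma at_least_two_heteroclinics (A : R) (k : Z) :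
  0 < A ->
  at_least_two (fun y => is_heteroclinic A y /\
    joins y (2 * IZR k * PI) (2 * IZR k * PI + 2 * PI)).
Proof.
  intros HA.
  assert (HPI := PI_RGT_0).
  destruct (shoot_separatrix A HA) as [s [Hs [Hnf Hnt]]].
  assert (Hlim := separatrix_limit A s HA Hs Hnf Hnt).
  set (c := 2 * IZR k * PI).
  set (y := fun n => reflected (shoot A s) n + c).
  assert (Hsol : is_solution A y)
    by apply is_solution_translate, is_solution_reflected_shoot.
  assert (Hp : is_lim_seq (fun n => y (Z.of_nat n)) c).
  { apply (is_lim_seq_ext (fun n => shoot A s n + c)).
    - intros n; unfold y; now rewrite reflected_nonneg.
    - replace (Finite c) with (Finite (0 + c)) by (f_equal; ring).
      apply is_lim_seq_plus'; [exact Hlim | apply is_lim_seq_const]. }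
  assert (Hm : is_lim_seq (fun n => y (- Z.of_nat n)%Z) (c + 2 * PI)).
  { apply (is_lim_seq_ext (fun n => 2 * PI - shoot A s n + c)).
    - intros n; unfold y; now rewrite reflected_nonpos.
    - replace (Finite (c + 2 * PI)) with (Finite (2 * PI - 0 + c)) by (f_equal; ring).
      apply is_lim_seq_plus'; [apply is_lim_seq_minus'|];
        solve [exact Hlim | apply is_lim_seq_const]. }
  assert (Hp' : is_lim_seq (fun n => y (- - Z.of_nat n)%Z) c).
  { apply (is_lim_seq_ext (fun n => y (Z.of_nat n))); [|exact Hp].
    intros n; now rewrite Z.opp_involutive. }
  assert (Ec : is_equilibrium A c) by (apply is_equilibrium_Theta; now exists k).
  assert (Ec' : is_equilibrium A (c + 2 * PI)).
  { apply is_equilibrium_Theta; exists (k + 1)%Z; rewrite plus_IZR; unfold c; ring. }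
  exists y, (fun n => y (- n)%Z); split; [|split; split].
  (* At time 1 the two orbits take the values [s + c] and [2 * PI - s + c], which differ because
     [s < PI]. *)
  - intros E; apply (f_equal (fun f => f 1%Z)) in E; revert E; unfold y.
    change (-(1))%Z with (- Z.of_nat 1)%Z; change 1%Z with (Z.of_nat 1).
    rewrite reflected_nonneg, reflected_nonpos by reflexivity; simpl; lra.
  - split; [exact Hsol|]; exists (c + 2 * PI), c.
    repeat split; try assumption; lra.
  - right; split; assumption.
  - split; [now apply is_solution_opp|]; exists c, (c + 2 * PI).
    repeat split; try assumption; lra.
  - left; split; assumption.
Qed.

Theorem theorem2p2 :
  forall (A : R), 0 < A ->
  forall (xi : R), Theta xi ->
    at_least_two (fun y => is_heteroclinic A y /\ joins y (xi - 2 * PI) xi) /\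
    at_least_two (fun y => is_heteroclinic A y /\ joins y xi (xi + 2 * PI)).
Proof.
  intros A HA xi [k ->]; split; [|now apply at_least_two_heteroclinics].
  (* The pair ending at [xi] on the right is the one based at the preceding multiple of [2 * PI]. *)
  assert (H := at_least_two_heteroclinics A (k - 1) HA).
  rewrite minus_IZR in H.
  replace (2 * (IZR k - 1) * PI + 2 * PI) with (2 * IZR k * PI) in H by ring.
  replace (2 * (IZR k - 1) * PI) with (2 * IZR k * PI - 2 * PI) in H by ring.
  exact H.
Qed.
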